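(* For Independent Set in the Late Accept/Reject model, Algorithm 1 (defined in the context) is strictly $\frac{3\sqrt3}{2}$-competitive; that is, for every input $\sigma$, the independent set $S$ held by Algorithm 1 after processing $\sigma$ satisfies $\mathrm{OPT}(\sigma)\le \frac{3\sqrt3}{2}\,|S|$.
   Context: Online Independent Set (vertex arrival). An input $\sigma$ is a finite simple undirected graph $G=(V,E)$ together with an ordering of its vertices. Vertices arrive one by one in this order; when a vertex arrives, all edges between it and previously arrived vertices are revealed. The algorithm maintains a set of currently accepted vertices, which must be an independent set of the graph revealed so far. $\mathrm{OPT}(\sigma)$ is the maximum cardinality of an independent set of $G$; the objective is maximization. Late Accept/Reject model: in each step the algorithm may accept the newly arrived vertex and any earlier vertices that have not been late-rejected, and it may remove (late-reject) accepted vertices; a late-rejected vertex can never be accepted again. Algorithm 1. At any time, $S$ is the set of vertices that have been accepted and not late-rejected, $R$ is the set of vertices that have been late-rejected, and $P$ is the set of all other vertices that have arrived (those never accepted). $N(v)$ is the neighborhood of $v$ (not including $v$) and $N(U)=\bigcup_{v\in U}N(v)$. A nonempty set $T$ of vertices is admissible if (1) $T$ is an independent set; (2) $T\subseteq P$; (3) $|T|\ge \sqrt3\,|N(T)\cap S|$. Initially $S=\emptyset$. When a vertex $v$ arrives: if $S\cup\{v\}$ is independent, then set $S:=S\cup\{v\}$; otherwise, while there exists an admissible set, let $T$ be an admissible set minimizing $|S\cap N(T)|$ (ties broken arbitrarily) and set $S:=(S-N(T))\cup T$ (so the vertices of $S\cap N(T)$ become late-rejected). *)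

(* Defs.v *)
From HB Require Import structures.
From mathcomp Require Import all_boot all_order all_algebra.

Set Implicit Arguments.
Unset Strict Implicit.
Unset Printing Implicit Defensive.

Import Order.TTheory GRing.Theory Num.Theory.

Section Graph.

Variables (V : finType) (e : rel V).
Implicit Types A : {set V}.

Definition independent A : bool := [forall u in A, forall v in A, ~~ e u v].

Definition neighborhood A : {set V} := \bigcup_(v in A) [set u | e v u].

(* The maximum cardinality of an independent set. *)
Definition OPT : nat := \max_(A : {set V} | independent A) #|A|.

End Graph.

(* [accepted] and [late_rejected] are the sets S and R of the algorithm. *)
Record state (V : finType) := State {
  arrived : {set V};
  accepted : {set V};
  late_rejected : {set V} }.

(* The set P of the algorithm: a vertex enters R only by leaving S, so the
   arrived vertices outside S and R are those that were never accepted. *)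
Definition pending (V : finType) (st : state V) : {set V} :=
  arrived st :\: (accepted st :|: late_rejected st).

Definition init_state (V : finType) : state V := State set0 set0 set0.

(* Neighborhoods below are taken in the whole graph, but they only occur
   intersected with, or removed from, the set S of accepted vertices, and
   independence is only tested on sets of arrived vertices: every decision
   depends on the revealed part of the graph alone. *)
Section Algorithm.

Variables (K : rcfType) (V : finType) (e : rel V).
Implicit Types (st : state V) (T : {set V}).

Definition lost st T : {set V} := accepted st :&: neighborhood e T.

Definition admissible st T : bool :=
  [&& T != set0, independent e T, T \subset pending st
    & ((Num.sqrt 3 : K) * #|lost st T|%:R <= #|T|%:R)%R].

Definition min_admissible st T : Prop :=
  admissible st T /\
  forall T', admissible st T' -> #|lost st T| <= #|lost st T'|.

Definition switch st T : state V :=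
  State (arrived st)
        ((accepted st :\: neighborhood e T) :|: T)
        (late_rejected st :|: lost st T).

(* The algorithm is a relation between states because ties are broken
   arbitrarily: [while_loop st st'] holds when the loop started in [st] can
   terminate in [st']. *)
Inductive while_loop : state V -> state V -> Prop :=
| WhileExit st : (forall T, ~~ admissible st T) -> while_loop st st
| WhileIter st T st' :
    min_admissible st T -> while_loop (switch st T) st' -> while_loop st st'.

Inductive process_vertex st (v : V) : state V -> Prop :=
| ProcessAccept :
    independent e (v |: accepted st) ->
    process_vertex st v
      (State (v |: arrived st) (v |: accepted st) (late_rejected st))
| ProcessLoop st' :
    ~~ independent e (v |: accepted st) ->
    while_loop (State (v |: arrived st) (accepted st) (late_rejected st)) st' ->
    process_vertex st v st'.

Inductive run : state V -> seq V -> state V -> Prop :=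
| RunNil st : run st [::] st
| RunCons st v sigma st1 st2 :
    process_vertex st v st1 -> run st1 sigma st2 -> run st (v :: sigma) st2.

(* Whatever the tie-breaking, the loop terminates (the set P strictly
   shrinks), and every input has at least one run. *)
Lemma pending_switch st T :
  admissible st T -> #|pending (switch st T)| < #|pending st|.
Proof.
case/and4P=> T0 _ sTP _; apply: proper_card; apply/properP; split.
  apply/subsetP=> x; rewrite !inE !negb_or !negb_and !negbK.
  by case: (x \in accepted st); case: (x \in late_rejected st);
     case: (x \in neighborhood e T); case: (x \in T).
have [x xT] := set0Pn _ T0; exists x; first exact: (subsetP sTP).
by rewrite !inE xT !orbT.
Qed.

Lemma while_loop_exists st : exists st', while_loop st st'.
Proof.
have [n] := ubnP #|pending st|; elim: n st => // n IHn st ltPn.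
case: (pickP (admissible st)) => [T0 adT0 | noT]; last first.
  by exists st; apply: WhileExit => T; rewrite noT.
case: (arg_minnP (fun T => #|lost st T|) adT0) => T adT minT.
have [|st' loop_st'] := IHn (switch st T).
  exact: leq_trans (pending_switch adT) _.
by exists st'; apply: WhileIter loop_st'.
Qed.

Lemma run_exists st sigma : exists st', run st sigma st'.
Proof.
elim: sigma st => [|v sigma IHs] st; first by exists st; apply: RunNil.
have [st1 step1] : exists st1, process_vertex st v st1.
  have [indep | dep] := boolP (independent e (v |: accepted st)).
    by eexists; apply: ProcessAccept.
  have [st1 loop1] :=
    while_loop_exists (State (v |: arrived st) (accepted st) (late_rejected st)).
  by exists st1; apply: ProcessLoop.
by have [st2 run2] := IHs st1; exists st2; apply: RunCons step1 run2.
Qed.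

End Algorithm.

(* Main.v *)
(** Fix an independent set A. Throughout the run, the sets S and R satisfy
    2 |R ∩ A| <= |S ∩ A| + sqrt 3 |S - A|.
    Indeed, let T be the chosen admissible set and L = S ∩ N(T). As A is
    independent, T ∩ A only destroys vertices of L - A. If T ∩ A is admissible,
    then minimality forces L to be disjoint from A; otherwise
    |T ∩ A| <= sqrt 3 |L - A|. In both cases |T| >= sqrt 3 |L| shows that
    the inequality survives the switch. At the end A ∩ P is not admissible,
    so |A ∩ P| <= sqrt 3 |S - A|, and adding up gives
    |A| <= 3/2 |S ∩ A| + 3 sqrt 3 / 2 |S - A|. *)
Require Import Defs.
From mathcomp Require Import all_boot all_order all_algebra.
From mathcomp Require Import lra.
Set Implicit Arguments.
Unset Strict Implicit.
Unset Printing Implicit Defensive.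

Import Order.TTheory GRing.Theory Num.Theory.
Local Open Scope ring_scope.

(** * Independent sets and neighborhoods *)

Section Graph.

Variables (V : finType) (e : rel V).
Implicit Types A B T : {set V}.

Lemma independentP A :
  reflect {in A &, forall u v, ~~ e u v} (independent e A).
Proof.
apply: (iffP forall_inP) => [indA u v uA vA | indA u uA].
  exact: (forall_inP (indA u uA)).
by apply/forall_inP => v vA; apply: indA.
Qed.

Lemma neighborhoodP A u :
  reflect (exists2 v, v \in A & e v u) (u \in neighborhood e A).
Proof.
apply: (iffP bigcupP) => -[v vA evu]; exists v => //; last by rewrite inE.
by rewrite inE in evu.
Qed.

Lemma independentS A B : A \subset B -> independent e B -> independent e A.
Proof.
move=> /subsetP sAB /independentP indB; apply/independentP => u v uA vA.
by apply: indB; apply: sAB.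
Qed.

Lemma neighborhoodS A B :
  A \subset B -> neighborhood e A \subset neighborhood e B.
Proof.
move=> /subsetP sAB; apply/subsetP => u /neighborhoodP[v vA evu].
by apply/neighborhoodP; exists v => //; apply: sAB.
Qed.

Lemma independent_neighborhood A B :
  independent e A -> B \subset A -> [disjoint neighborhood e B & A].
Proof.
move=> /independentP indA /subsetP sBA.
apply/pred0P => u /=; apply/negbTE/negP => /andP[/neighborhoodP[v vB evu] uA].
by have := indA v u (sBA v vB) uA; rewrite evu.
Qed.

Lemma OPT_attained : exists2 A, independent e A & OPT e = #|A|.
Proof.
have ind0 : independent e set0.
  by apply/independentP => u v; rewrite inE.
(* A maximum is attained only over a nonempty family; the empty set provides a member. *)
have ex0 : (0 < #|[pred A | independent e A]|)%N by apply/card_gt0P; exists set0.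
have [A indA eqA] := eq_bigmax_cond (fun A : {set V} => #|A|) ex0.
by exists A.
Qed.

Lemma independent_switch (e_sym : symmetric e) S T :
  independent e S -> independent e T ->
  independent e ((S :\: neighborhood e T) :|: T).
Proof.
move=> /independentP indS /independentP indT.
have crossing u v : u \in T -> v \in S :\: neighborhood e T -> ~~ e u v.
  move=> uT /setDP[_]; apply: contra => euv.
  by apply/neighborhoodP; exists u.
apply/independentP => u v /setUP[uS | uT] /setUP[vS | vT].
- by case/setDP: uS => uS _; case/setDP: vS => vS _; apply: indS.
- by rewrite e_sym; apply: crossing.
- exact: crossing.
- exact: indT.
Qed.

End Graph.

(** * The balance inequality and its preservation by single moves *)

Section Competitiveness.

Variables (K : rcfType) (V : finType) (e : rel V).
Implicit Types (st : state V) (T : {set V}).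

Local Notation r := (Num.sqrt 3 : K).

Lemma sqrt3_sqr : r * r = 3.
Proof. by rewrite -expr2 sqr_sqrtr. Qed.

Lemma sqrt3_ge1 : 1 <= r.
Proof. by rewrite -[leLHS]sqrtr1 ler_sqrt ?ler1n. Qed.

Lemma natr_cardsID (A B : {set V}) :
  #|A|%:R = #|A :&: B|%:R + #|A :\: B|%:R :> K.
Proof. by rewrite -natrD cardsID. Qed.

(** Only emptiness, where the bound is trivial, or a failure of the size condition can make such a
    [T] inadmissible. *)
Lemma not_admissible_card st T :
  ~~ admissible K e st T -> independent e T -> T \subset pending st ->
  #|T|%:R <= r * #|lost e st T|%:R.
Proof.
move=> + indT sTP; rewrite /admissible indT sTP /=.
case: eqP => [-> _ | _ /=]; last by rewrite -ltNge; apply: ltW.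
by rewrite cards0 mulr_ge0 ?sqrtr_ge0 ?ler0n.
Qed.

Definition stuck st : Prop := forall T, ~~ admissible K e st T.

(** Direct acceptance bypasses the loop. It adds nothing to P and can only enlarge the loss of a set
    [T], so a set admissible afterwards was admissible before. *)
Lemma stuck_accept st v :
  stuck st ->
  stuck (State (v |: arrived st) (v |: accepted st) (late_rejected st)).
Proof.
move=> stuck_st T; apply: contra (stuck_st T) => /and4P[T0 indT sTP leT].
apply/and4P; split=> //.
  apply: subset_trans sTP _; apply/subsetP => x; rewrite !inE /=.
  by case: eqP.
apply: le_trans leT; rewrite ler_wpM2l ?sqrtr_ge0 // ler_nat.
by apply/subset_leq_card/setSI/subsetUr.
Qed.

Definition balanced (A : {set V}) st : Prop :=
  2 * #|late_rejected st :&: A|%:R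
    <= #|accepted st :&: A|%:R + r * #|accepted st :\: A|%:R.

Lemma balanced_accept A st v :
  balanced A st ->
  balanced A (State (v |: arrived st) (v |: accepted st) (late_rejected st)).
Proof.
rewrite /balanced /= => bal; apply: le_trans bal _.
apply: lerD; last rewrite ler_wpM2l ?sqrtr_ge0 //.
  by rewrite ler_nat; apply/subset_leq_card/setSI/subsetUr.
by rewrite ler_nat; apply/subset_leq_card/setSD/subsetUr.
Qed.

Lemma pending_disjoint st T :
  T \subset pending st -> [disjoint T & accepted st].
Proof.
move=> /subsetP sTP; apply/pred0P => x /=; apply/negbTE/negP => /andP[xT xS].
by have := sTP x xT; rewrite !inE xS.
Qed.

(** This is what one switch needs to keep the balance. A vertex of L in A costs 3: it adds 2 to the
    left side by entering R and takes 1 from the right side by leaving S. *)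
Lemma min_admissible_exchange A st T :
  independent e A -> min_admissible K e st T ->
  3 * #|lost e st T :&: A|%:R + r * #|lost e st T :\: A|%:R
    <= #|T :&: A|%:R + r * #|T :\: A|%:R.
Proof.
move=> indA [/and4P[_ indT sTP leT] minT].
move: leT; rewrite (natr_cardsID T A) (natr_cardsID (lost e st T) A) => leT.
have lostTA : lost e st (T :&: A) \subset lost e st T :\: A.
  rewrite subsetD setIS ?neighborhoodS ?subsetIl //=.
  apply: disjointWl (subsetIr _ _) _.
  exact: independent_neighborhood indA (subsetIr _ _).
have r2 := sqrt3_sqr; have r1 := sqrt3_ge1.
have T0 : 0 <= #|T :\: A|%:R :> K by apply: ler0n.
have [admTA | notTA] := boolP (admissible K e st (T :&: A)).
  (* Minimality gives |L| <= |S ∩ N(T ∩ A)| <= |L - A|, which leaves no vertex of L in A. *)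
  have LA0 : #|lost e st T :&: A| = 0%N.
    have := leq_trans (minT _ admTA) (subset_leq_card lostTA).
    by rewrite -(cardsID A (lost e st T)) -[leqRHS]add0n leq_add2r leqn0 => /eqP.
  by move: leT; rewrite LA0; nra.
have leTA : #|T :&: A|%:R <= r * #|lost e st T :\: A|%:R.
  apply: (@le_trans _ _ (r * #|lost e st (T :&: A)|%:R)); last first.
    by rewrite ler_wpM2l ?sqrtr_ge0 // ler_nat subset_leq_card.
  apply: not_admissible_card notTA (independentS (subsetIl T A) indT) _.
  exact: subset_trans (subsetIl T A) sTP.
(* The goal is the sum of [leT] scaled by [r] and (r - 1)(r |L - A| - |T ∩ A|) >= 0. Once [r * r] is
   replaced by 3, the remaining products with [r] act as atoms for [lra]. *)
have := ler_wpM2l (sqrtr_ge0 _ : 0 <= r) leT.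
have := mulr_ge0 (_ : 0 <= r - 1)
  (_ : 0 <= r * #|lost e st T :\: A|%:R - #|T :&: A|%:R).
rewrite !subr_ge0 => /(_ r1 leTA).
move: (#|T :&: A|%:R : K) (#|T :\: A|%:R : K) => tp tm.
move: (#|lost e st T :&: A|%:R : K) (#|lost e st T :\: A|%:R : K) => lp lm.
rewrite mulrBr !mulrBl !mul1r !mulrDr !mulrA r2.
lra.
Qed.

Lemma balanced_switch A st T :
  independent e A -> min_admissible K e st T ->
  balanced A st -> balanced A (switch e st T).
Proof.
move=> indA minT; have := min_admissible_exchange indA minT.
case: minT => /and4P[_ _ /pending_disjoint TS _] _; rewrite /balanced /=.
set S := accepted st; set N := neighborhood e T; set L := lost e st T.
(* Used for both [A] and its complement, to follow the two terms on the right side of the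
   balance. *)
have card_switch (X : {set V}) :
    #|((S :\: N) :|: T) :&: X|%:R
      = #|S :&: X|%:R - #|L :&: X|%:R + #|T :&: X|%:R :> K.
  have dT : [disjoint (S :\: N) :&: X & T :&: X].
    apply: disjointW (subsetIl _ _) (subsetIl _ _) _.
    by rewrite disjoint_sym; apply: disjointWr (subsetDl _ _) TS.
  rewrite setIUl cardsU (disjoint_setI0 dT) cards0 subn0 natrD.
  rewrite (natr_cardsID (S :&: X) N) setIAC -/L setIDAC.
  by rewrite [X in _ = X + _]addrAC subrr add0r.
have leR : #|(late_rejected st :|: L) :&: A|%:R
    <= #|late_rejected st :&: A|%:R + #|L :&: A|%:R :> K.
  by rewrite -natrD ler_nat setIUl leq_card_setU.
have := card_switch (~: A); rewrite -!setDE card_switch => ->.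
lra.
Qed.

(** * Invariants along a run and the final count *)

Lemma while_loop_inv st st' (e_sym : symmetric e) :
  while_loop K e st st' -> independent e (accepted st) ->
  [/\ independent e (accepted st'), arrived st' = arrived st, stuck st'
    & forall A, independent e A -> balanced A st -> balanced A st'].
Proof.
elim=> {st st'} [st stuck_st | st T st' minT _ IH] indS; first by split.
have indT : independent e T by case: minT => /and4P[].
have [//| ? ? ? bal] := IH; first exact: independent_switch.
by split=> // A indA balA; apply/bal/balanced_switch.
Qed.

Lemma run_inv st sigma st' (e_sym : symmetric e) :
  run K e st sigma st' -> independent e (accepted st) -> stuck st ->
  [/\ independent e (accepted st'), arrived st' = [set:: sigma] :|: arrived st,
      stuck st'
    & forall A, independent e A -> balanced A st -> balanced A st'].
Proof.
elim=> {st sigma st'} [st | st v sigma st1 st2 step _ IH] indS stuck_st.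
  by split=> //; apply/setP => x; rewrite !inE.
have [indS1 arr1 stuck1 bal1] : [/\ independent e (accepted st1),
    arrived st1 = v |: arrived st, stuck st1
  & forall A, independent e A -> balanced A st -> balanced A st1].
  case: step => [indv | st1' _ loop].
    split=> //; first exact: stuck_accept.
    by move=> A _; apply: balanced_accept.
  exact: while_loop_inv e_sym loop indS.
have [indS2 arr2 stuck2 bal2] := IH indS1 stuck1.
split=> // [|A indA balA]; last by apply: bal2 => //; apply: bal1.
by rewrite arr2 arr1; apply/setP => x; rewrite !inE orbCA orbA.
Qed.

Lemma card_independent A st :
  arrived st = setT -> stuck st -> balanced A st -> independent e A ->
  #|A|%:R <= 3 * r / 2 * #|accepted st|%:R.
Proof.
move=> arr stuck_st bal indA.
have leP : #|pending st :&: A|%:R <= r * #|accepted st :\: A|%:R.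
  have sPA := subsetIr (pending st) A.
  have indP := independentS sPA indA.
  (* A ∩ P is inadmissible, and its neighbors in S lie outside A. *)
  apply: le_trans (not_admissible_card (stuck_st _) indP (subsetIl _ _)) _.
  rewrite ler_wpM2l ?sqrtr_ge0 // ler_nat subset_leq_card //.
  rewrite subsetD subsetIl /=; apply: disjointWl (subsetIr _ _) _.
  exact: independent_neighborhood indA sPA.
have leA : #|A|%:R <= #|accepted st :&: A|%:R + #|late_rejected st :&: A|%:R
                      + #|pending st :&: A|%:R :> K.
  rewrite -!natrD ler_nat.
  have sA : A \subset (accepted st :&: A) :|: (late_rejected st :&: A)
                        :|: (pending st :&: A).
    apply/subsetP => x xA; rewrite !inE arr inE xA.
    by case: (x \in accepted st); case: (x \in late_rejected st).
  apply: leq_trans (subset_leq_card sA) _.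
  by apply: leq_trans (leq_card_setU _ _) _; rewrite leq_add2r leq_card_setU.
rewrite (natr_cardsID (accepted st) A).
have Sp : 0 <= #|accepted st :&: A|%:R :> K by apply: ler0n.
(* The count yields coefficient 3/2 on |S ∩ A|; [1 <= r] raises it to the coefficient 3r/2 of |S -
   A|. *)
have := ler_wpM2r Sp sqrt3_ge1.
move: leA leP bal; rewrite /balanced; lra.
Qed.

End Competitiveness.

Theorem theorem4 (K : rcfType) (V : finType) (e : rel V)
    (e_sym : symmetric e) (e_irr : irreflexive e)
    (sigma : seq V) (sigma_order : perm_eq sigma (enum V))
    (st : state V) (run_st : run K e (init_state V) sigma st) :
  independent e (accepted st) /\
  (OPT e)%:R <= (3 * Num.sqrt 3 / 2 : K) * #|accepted st|%:R.
Proof.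
have ind0 : independent e (accepted (init_state V)).
  by apply/independentP => u v; rewrite inE.
(* Nothing has arrived yet, so P is empty and has no nonempty subset. *)
have stuck0 : stuck K e (init_state V).
  move=> T; apply/negP => /and4P[T0 _ + _].
  by rewrite /pending set0D subset0 (negbTE T0).
have [indS arr stuck_st bal] := run_inv e_sym run_st ind0 stuck0.
split=> //; have [A indA ->] := OPT_attained e.
apply: (@card_independent _ _ e A) => //.
  by apply/setP => x; rewrite arr !inE (perm_mem sigma_order) mem_enum.
apply: bal => //.
by rewrite /balanced /= !set0I set0D cards0 !mulr0 addr0.
Qed.
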